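(* Let $H$ be a complex Hilbert space and let $\{f_k\}_{k=1}^\infty$ and $\{g_k\}_{k=1}^\infty$ be Riesz bases for $H$. Then $\{f_k\}_{k=1}^\infty$ and $\{g_k\}_{k=1}^\infty$ are complete in $H$, and the cross-Gram matrix $\{\langle f_k,g_j\rangle\}_{j,k=1}^\infty$ associated to $\{f_k\}_{k=1}^\infty$ and $\{g_k\}_{k=1}^\infty$ defines a bounded invertible operator on $\ell^2(\mathbb{N})$.
   Context: Inner products are linear in the first argument. A Riesz basis for $H$ is a family of the form $\{Ue_k\}_{k=1}^\infty$, where $\{e_k\}_{k=1}^\infty$ is an orthonormal basis for $H$ and $U:H\to H$ is a bounded bijective linear operator. A sequence is complete in $H$ if its closed linear span is $H$. The cross-Gram matrix has $(j,k)$ entry $\langle f_k,g_j\rangle$ and defines the operator $\{c_k\}_{k=1}^\infty\mapsto\left\{\sum_{k=1}^\infty c_k\langle f_k,g_j\rangle\right\}_{j=1}^\infty$ on $\ell^2(\mathbb{N})$. Invertible means bijective with bounded inverse. *)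

(* Defs.v *)
From HB Require Import structures.
From mathcomp Require Import all_boot all_order all_algebra complex.
From mathcomp Require Import all_classical all_reals all_analysis.

Set Implicit Arguments.
Unset Strict Implicit.
Unset Printing Implicit Defensive.

Import Order.TTheory GRing.Theory Num.Theory.
Import numFieldNormedType.Exports.
Import Normc.

Local Open Scope classical_set_scope.
Local Open Scope ring_scope.
Local Open Scope complex_scope.

(* The complex numbers are [R[i]] with [R : realType].  Norms on
   [normedModType R[i]] take their values in [R[i]]; [normc z : R] is the
   modulus of [z] as a real number, and [R[i]^o] is [R[i]] with its usual
   topology. *)

Section HilbertSpace.
Context (R : realType) (H : completeNormedModType R[i]).
Context (dot : {dot H for @Num.conj R[i]}).

Definition linear_span (f : nat -> H) : set H :=
  [set x | exists n (a : nat -> R[i]), x = \sum_(k < n) a k *: f k].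

Definition complete_sequence (f : nat -> H) : Prop :=
  closure (linear_span f) = setT.

Definition orthonormal_basis (e : nat -> H) : Prop :=
  (forall j k, dot (e j) (e k) = (j == k)%:R) /\ complete_sequence e.

Definition bounded_operator (U : {linear H -> H}) : Prop :=
  exists M : R, forall x, `|U x| <= M%:C * `|x|.

Definition riesz_basis (f : nat -> H) : Prop :=
  exists (e : nat -> H) (U : {linear H -> H}),
    [/\ orthonormal_basis e, bounded_operator U, bijective U &
        forall k, f k = U (e k)].

(* [cross_gram f g j k] is the entry of row [j] and column [k]. *)
Definition cross_gram (f g : nat -> H) (j k : nat) : R[i] := dot (f k) (g j).

End HilbertSpace.

Section SquareSummable.
Context (R : realType).
Implicit Types (c d : nat -> R[i]) (T : (nat -> R[i]) -> nat -> R[i]).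

Definition l2 : set (nat -> R[i]) :=
  [set c | cvgn (series (fun k => normc (c k) ^+ 2 : R))].

Definition l2norm c : R :=
  Num.sqrt (limn (series (fun k => normc (c k) ^+ 2 : R))).

(* Operators on l2 are represented by maps on all sequences, of which only
   the restriction to [l2] is significant. *)
Definition l2_bounded_operator T : Prop :=
  [/\ set_fun l2 l2 T,
      forall (a : R[i]) c d, l2 c -> l2 d ->
        T (fun k => a * c k + d k) = (fun k => a * T c k + T d k) &
      exists M : R, forall c, l2 c -> l2norm (T c) <= M * l2norm c].

Definition l2_invertible T : Prop :=
  set_bij l2 l2 T /\
  exists2 S, l2_bounded_operator S & forall c, l2 c -> S (T c) = c.

Definition matrix_series (A : nat -> nat -> R[i]) c (j : nat) : nat -> R[i]^o :=
  series (fun k => c k * A j k : R[i]^o).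

(* Since [limn] is total, convergence of the series is required separately. *)
Definition matrix_operator (A : nat -> nat -> R[i]) c : nat -> R[i] :=
  fun j => limn (matrix_series A c j).

Definition defines_bounded_invertible (A : nat -> nat -> R[i]) : Prop :=
  [/\ forall c, l2 c -> forall j, cvgn (matrix_series A c j),
      l2_bounded_operator (matrix_operator A) &
      l2_invertible (matrix_operator A)].

End SquareSummable.

(* Main.v *)
(** Write f = U e and g = V e' with e, e' orthonormal bases.  The vectors of [H]
    correspond to the sequences of [l2] through x |-> (<U^-1 x, e_k>)_k, the
    coordinates of x along f, and in these coordinates the cross-Gram matrix is
    the analysis operator x |-> (<x, g_j>)_j.  The latter is injective because g
    is complete, and surjective because (V^-1)^* (sum_j d_j e'_j) has analysis
    sequence d.  All bounds follow from those of U, V and, by a Baire category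
    argument, of their inverses. *)
Require Import Defs.
From HB Require Import structures.
From mathcomp Require Import all_boot all_order all_algebra complex ring lra.
From mathcomp Require Import all_classical all_reals all_analysis.
Import Order.TTheory GRing.Theory Num.Theory.
Import numFieldNormedType.Exports.
Import Normc.
Local Open Scope classical_set_scope.
Local Open Scope ring_scope.
Local Open Scope complex_scope.
Set Implicit Arguments.
Unset Strict Implicit.
Unset Printing Implicit Defensive.

(** * The modulus, and a real-valued norm on complex normed spaces *)

Section Modulus.
Context (R : realType).

Lemma normc_ge0 (z : R[i]) : 0 <= normc z.
Proof. by case: z => a b; apply: sqrtr_ge0. Qed.

Lemma normc_real (r : R) : 0 <= r -> normc r%:C = r.
Proof. by move=> r0; rewrite /normc /= expr0n addr0 sqrtr_sqr ger0_norm. Qed.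

End Modulus.

Section RealNorm.
Context (R : realType) (H : normedModType R[i]).
Implicit Types (x y : H) (u : nat -> H).

(** The norm [|x|] is a complex number with zero imaginary part; its real part lives in [R], where
    the order is total and real limit theorems apply. *)
Definition nrm x : R := complex.Re `|x|.

Lemma nrmE x : (nrm x)%:C = `|x|.
Proof. by rewrite /nrm RRe_real // normr_real. Qed.

Lemma nrm_ge0 x : 0 <= nrm x.
Proof. by rewrite -ler0c nrmE. Qed.

Lemma nrm_eq0 x : (nrm x == 0) = (x == 0).
Proof. by rewrite -[RHS]normr_eq0 -nrmE -(inj_eq (@complexI R)). Qed.

Lemma nrm0 : nrm 0 = 0.
Proof. by apply/eqP; rewrite nrm_eq0. Qed.

Lemma nrm_gt0 x : (0 < nrm x) = (x != 0).
Proof. by rewrite lt_def nrm_eq0 nrm_ge0 andbT. Qed.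

Lemma nrmN x : nrm (- x) = nrm x.
Proof. by rewrite /nrm normrN. Qed.

Lemma nrmC x y : nrm (x - y) = nrm (y - x).
Proof. by rewrite -nrmN opprB. Qed.

Lemma nrmZ a x : nrm (a *: x) = normc a * nrm x.
Proof. by apply: complexI; rewrite nrmE normrZ rmorphM /= nrmE. Qed.

Lemma ler_nrmD x y : nrm (x + y) <= nrm x + nrm y.
Proof. by rewrite -lecR rmorphD /= !nrmE ler_normD. Qed.

Lemma ler_nrmB x y : nrm (x - y) <= nrm x + nrm y.
Proof. by rewrite (le_trans (ler_nrmD _ _)) ?nrmN. Qed.

Lemma ler_dist_nrm x y : `|nrm x - nrm y| <= nrm (x - y).
Proof.
have h a b : nrm a <= nrm (a - b) + nrm b.
  by rewrite (le_trans _ (ler_nrmD _ _)) ?subrK.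
rewrite ler_norml; have := h x y; have := h y x; rewrite (nrmC y); lra.
Qed.

Lemma cvg_nrmP u x : u @ \oo --> x <-> nrm (u n - x) @[n --> \oo] --> (0 : R).
Proof.
split=> [/cvgrPdist_lt ux|/cvgrPdist_lt ux].
  apply/cvgrPdist_lt => e e0; have := ux e%:C; rewrite ltcR => /(_ e0).
  apply: filterS => n; rewrite -nrmE ltcR sub0r normrN ger0_norm ?nrm_ge0 //.
  by rewrite nrmC.
(* A positive [e : R[i]] has zero imaginary part, so [complex.Re e] serves as the real tolerance. *)
apply/cvgrPdist_lt => e; rewrite ltcE /= => /andP[/eqP ie re].
have := ux (complex.Re e) re; apply: filterS => n.
rewrite sub0r normrN ger0_norm ?nrm_ge0 // nrmC => h.
by rewrite -nrmE ltcE /= ie eqxx.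
Qed.

Lemma cvg_nrm u x : u @ \oo --> x -> nrm (u n) @[n --> \oo] --> nrm x.
Proof.
move=> /cvg_nrmP ux; apply/cvgrPdist_lt => e e0.
have /cvgrPdist_lt/(_ e e0) := ux; apply: filterS => n.
rewrite sub0r normrN ger0_norm ?nrm_ge0 // distrC.
exact/le_lt_trans/ler_dist_nrm.
Qed.

Lemma cvg_nrm_squeeze u x (b : nat -> R) :
  (forall n, nrm (u n - x) <= b n) -> b @ \oo --> (0 : R) -> u @ \oo --> x.
Proof.
move=> ub b0; apply/cvg_nrmP; apply: squeeze_cvgr (cvg_cst _) b0.
by near=> n; rewrite nrm_ge0 ub.
Unshelve. all: end_near. Qed.

Lemma cvg_nrm_unique u x y : u @ \oo --> x -> u @ \oo --> y -> x = y.
Proof. exact: cvg_unique. Qed.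

Lemma nrm_lim_le u x B :
  u @ \oo --> x -> (\forall n \near \oo, nrm (u n) <= B) -> nrm x <= B.
Proof.
move=> /cvg_nrm ux uB; rewrite -(cvg_lim _ ux)//.
by apply: limr_le => //; apply/cvg_ex; exists (nrm x).
Qed.

Lemma cvg_bounded_linear (U : {linear H -> H}) (M : R) u x :
    (forall y, nrm (U y) <= M * nrm y) -> u @ \oo --> x ->
  U (u n) @[n --> \oo] --> U x.
Proof.
move=> UM /cvg_nrmP ux.
apply: (@cvg_nrm_squeeze _ _ (fun n => `|M| * nrm (u n - x))) => [n|].
  by rewrite -linearB (le_trans (UM _)) // ler_wpM2r ?nrm_ge0 // ler_norm.
by rewrite -[X in _ --> X](mulr0 `|M|); apply: cvgMr.
Qed.

Lemma cvg_linear_series (U : {linear H -> H}) (M : R) (c : nat -> R[i]) u x :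
    (forall y, nrm (U y) <= M * nrm y) ->
    \sum_(k < n) c k *: u k @[n --> \oo] --> x ->
  \sum_(k < n) c k *: U (u k) @[n --> \oo] --> U x.
Proof.
move=> UM /(cvg_bounded_linear UM); under eq_fun => n.
  rewrite linear_sum; under eq_bigr => k _ do rewrite linearZ.
  over.
by [].
Qed.

End RealNorm.

(** * Completeness, Baire category and boundedness of inverses *)

Section Complete.
Context (R : realType) (H : completeNormedModType R[i]).

Lemma cauchy_bound_cvg (u : nat -> H) (b : nat -> R) :
    (forall n m, (n <= m)%N -> nrm (u m - u n) <= b n) ->
  b @ \oo --> (0 : R) -> exists x : H, u @ \oo --> x.
Proof.
move=> ub /cvgrPdist_lt b0; exists (lim (u @ \oo)).
apply: (@cauchy_cvg H); apply: cauchy_exP.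
move=> e; rewrite ltcE /= => /andP[/eqP ie re].
have [N _ bN] := b0 (complex.Re e) re.
exists (u N); exists N => // m /= Nm; rewrite -ball_normE /=.
have := bN N (leqnn N); rewrite /= sub0r normrN => h.
rewrite -nrmE ltcE /= ie eqxx /= nrmC (le_lt_trans (ub _ _ Nm)) //.
by rewrite (le_lt_trans (ler_norm _) h).
Qed.

End Complete.

Section BoundedInverse.
Context (R : realType) (H : completeNormedModType R[i]).
Implicit Types (x y z : H).

Lemma cvg_geometric_half (a : R) : a * 2^-1 ^+ n @[n --> \oo] --> (0 : R).
Proof.
rewrite -[X in _ --> X](mulr0 a); apply: cvgMr; apply: cvg_expr.
by rewrite ger0_norm; lra.
Qed.

(** Baire's theorem in the form: some member of a countable cover is dense in a ball. Otherwise
    nested balls, the next one always avoiding [F n], shrink to a point that no [F n] contains. *)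
Lemma baire_cover (F : nat -> set H) : (forall x, exists n, F n x) ->
  exists n x0 (r : R), 0 < r /\ forall x, nrm (x - x0) < r ->
    forall e : R, 0 < e -> exists2 y, F n y & nrm (x - y) < e.
Proof.
move=> Fcover; apply: contrapT => nF.
(* Here [p] is an index with a ball (centre, radius), and [q] is a ball inside it, of at most half
   the radius, that misses [F p.1]. *)
have step (p : nat * (H * R)) : exists q : H * R, 0 < p.2.2 ->
    [/\ 0 < q.2, q.2 <= p.2.2 / 2, nrm (q.1 - p.2.1) + q.2 <= p.2.2 &
        forall y, F p.1 y -> q.2 < nrm (q.1 - y)].
  case: p => n [x0 r] /=; have [r0|r0] := ltP 0 r; last by exists (0, 0).
  have [x [xr [e [e0 Fe]]]] : exists x, nrm (x - x0) < r /\
      exists e : R, 0 < e /\ forall y, F n y -> e <= nrm (x - y).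
    apply: contrapT => nx; apply: nF; exists n, x0, r; split => // x xr e e0.
    apply: contrapT => ny; apply: nx; exists x; split => //; exists e.
    split => // y Fy; rewrite leNgt; apply/negP => ye; apply: ny.
    by exists y.
  have nr0 := nrm_ge0 (x - x0).
  (* Half of [e] keeps the new ball off [F n]; half of the remaining room keeps it inside the old
     ball. *)
  exists (x, Num.min (e / 2) ((r - nrm (x - x0)) / 2)) => _ /=.
  have m1 : Num.min (e / 2) ((r - nrm (x - x0)) / 2) <= e / 2.
    by rewrite ge_min lexx.
  have m2 : Num.min (e / 2) ((r - nrm (x - x0)) / 2) <= (r - nrm (x - x0)) / 2.
    by rewrite ge_min lexx orbT.
  split; [by rewrite lt_min; apply/andP; split; lra|lra|lra|].
  by move=> y /Fe; lra.
have [s sP] := choice step.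
pose fix ar n := if n is m.+1 then s (m, ar m) else (0, 1).
have r0 n : 0 < (ar n).2 by elim: n => //= n IH; case: (sP (n, ar n) IH).
have rE n : (ar n).2 <= 1 * 2^-1 ^+ n.
  elim: n => [|n IH] /=; first by rewrite expr0 mulr1.
  have [_ h _ _] := sP (n, ar n) (r0 n); apply: le_trans h _.
  by rewrite exprSr mulrA ler_pM2r ?invr_gt0.
have nested n m : (n <= m)%N ->
    nrm ((ar m).1 - (ar n).1) + (ar m).2 <= (ar n).2.
  elim: m => [|m IH].
    by rewrite leqn0 => /eqP ->; rewrite subrr nrm0 add0r.
  rewrite leq_eqVlt => /predU1P[->|/IH h]; first by rewrite subrr nrm0 add0r.
  have [_ _ /= h' _] := sP (m, ar m) (r0 m).
  have := ler_nrmD ((ar m.+1).1 - (ar m).1) ((ar m).1 - (ar n).1).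
  rewrite addrA subrK /=; lra.
have rb n m : (n <= m)%N -> nrm ((ar m).1 - (ar n).1) <= (ar n).2.
  by move=> /nested h; have := r0 m; lra.
have rcvg : (ar n).2 @[n --> \oo] --> (0 : R).
  apply: squeeze_cvgr (cvg_cst _) (cvg_geometric_half 1).
  by near=> n; rewrite rE ltW.
have [l al] := cauchy_bound_cvg rb rcvg.
have [N FN] := Fcover l.
(* The ball numbered [N.+1] misses [F N], yet it contains the limit [l], which lies in [F N]. *)
have [_ _ _ /(_ l FN)] := sP (N, ar N) (r0 N); apply/negP; rewrite -leNgt nrmC.
apply: (@nrm_lim_le _ _ (fun n => (ar n).1 - (ar N.+1).1)).
  exact: cvgB al (cvg_cst _).
by near=> n; apply: rb; near: n; exists N.+1.
Unshelve. all: end_near. Qed.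

(* Zabreiko's argument: by Baire some closure of [nrm (W y) <= n] contains a
   ball, so [z] is approximated by [y] with [nrm (W y) <= K * nrm z]; iterating
   on the remainder sums up to a preimage of [z]. *)
Lemma bounded_inverse (U W : {linear H -> H}) (M : R) :
    (forall x, nrm (U x) <= M * nrm x) -> cancel U W -> cancel W U ->
  exists K : R, forall x, nrm (W x) <= K * nrm x.
Proof.
move=> UM UW WU.
have [n [x0 [r [r0 xr]]]] : exists n x0 (r : R), 0 < r /\
    forall x, nrm (x - x0) < r ->
    forall e : R, 0 < e -> exists2 y, nrm (W y) <= n%:R & nrm (x - y) < e.
  apply: (@baire_cover (fun n => [set y | nrm (W y) <= n%:R])) => x.
  by exists (Num.bound (nrm (W x))); rewrite /= ltW // archi_boundP // nrm_ge0.
(* The ball around [x0] is moved to the origin: approximants of [z + x0] and of [x0] are subtracted,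
   which doubles the bound [n]. *)
have approx_ball z (e : R) : nrm z < r -> 0 < e ->
    exists y, nrm (W y) <= n%:R + n%:R /\ nrm (z - y) < e.
  move=> zr e0; have e2 : 0 < e / 2 by lra.
  have [|y1 y1n y1e] := xr (z + x0) _ _ e2; first by rewrite addrK.
  have [|y2 y2n y2e] := xr x0 _ _ e2; first by rewrite subrr nrm0.
  exists (y1 - y2); split.
    by rewrite linearB (le_trans (ler_nrmB _ _)) // lerD.
  have -> : z - (y1 - y2) = (z + x0 - y1) - (x0 - y2).
    by rewrite !opprB (addrAC z x0) addrACA subrr addr0 addrA [LHS]addrAC.
  by have := ler_nrmB (z + x0 - y1) (x0 - y2); lra.
(* A vector rescaled to norm [r / 2] has approximants with [nrm (W y)] at most [n%:R + n%:R]; by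
   homogeneity their quotient [K] works for every norm. *)
pose K := (n%:R + n%:R) / (r / 2).
have K0 : 0 <= K by rewrite divr_ge0 // ?addr_ge0 //; lra.
have approx z (e : R) : 0 < e ->
    exists y, nrm (W y) <= K * nrm z /\ nrm (z - y) < e.
  move=> e0; have [->|z0] := eqVneq z 0.
    by exists 0; rewrite linear0 subr0 nrm0 mulr0.
  have nz : 0 < nrm z by rewrite nrm_gt0.
  pose t := (r / 2) / nrm z.
  have t0 : 0 < t by rewrite divr_gt0 //; lra.
  have nt (s : R) x : 0 < s -> nrm (s%:C *: x) = s * nrm x.
    by move=> s0; rewrite nrmZ normc_real // ltW.
  have te : 0 < t * e by rewrite mulr_gt0.
  have [|y [yn ye]] := approx_ball (t%:C *: z) _ _ te.
    by rewrite nt // divfK ?gt_eqF //; lra.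
  have tV : t^-1%:C * t%:C = 1 by rewrite -rmorphM /= mulVf ?gt_eqF.
  exists (t^-1%:C *: y); split.
    rewrite linearZ nt ?invr_gt0 // mulrC ler_pdivrMr //.
    suff -> : K * nrm z * t = n%:R + n%:R by [].
    by rewrite /K /t; field; rewrite !gt_eqF.
  rewrite -[z]scale1r -tV -scalerA -scalerBr nt ?invr_gt0 //.
  by rewrite mulrC ltr_pdivrMr // mulrC.
clearbody K; exists (2 * K) => z; have [->|z0] := eqVneq z 0.
  by rewrite linear0 nrm0 mulr0.
have s0 : 0 < nrm z by rewrite nrm_gt0.
have step (p : nat * H) : exists y,
    nrm (W y) <= K * nrm p.2 /\ nrm (p.2 - y) < nrm z * 2^-1 ^+ p.1.+1.
  by apply: approx; rewrite mulr_gt0 // exprn_gt0.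
have [y yP] := choice step.
(* [zz k] is the remainder of [z] after [k] approximations, each of which at least halves the
   guaranteed bound. *)
pose fix zz k := if k is j.+1 then zz j - y (j, zz j) else z.
have zzE k : nrm (zz k) <= nrm z * 2^-1 ^+ k.
  case: k => [|k] /=; first by rewrite expr0 mulr1.
  by case: (yP (k, zz k)) => _ /ltW.
(* Step [k] changes [W (zz k)] by at most [K * nrm z * 2^-1 ^+ k]; the geometric sum is written as a
   difference so that the induction on [j] closes. *)
have Wzz k j : nrm (W (zz k) - W (zz (k + j)%N)) <=
    2 * K * nrm z * 2^-1 ^+ k - 2 * K * nrm z * 2^-1 ^+ (k + j).
  elim: j => [|j IH]; first by rewrite addn0 !subrr nrm0.
  rewrite addnS /= linearB.
  have [h _] := yP ((k + j)%N, zz (k + j)%N).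
  have {}h : nrm (W (y ((k + j)%N, zz (k + j)%N))) <=
      K * (nrm z * 2^-1 ^+ (k + j)).
    exact: le_trans h (ler_wpM2l K0 (zzE _)).
  set w := y _ in h *.
  have := ler_nrmD (W (zz k) - W (zz (k + j)%N)) (W w).
  rewrite opprB addrA addrAC exprSr.
  move: IH h; move: (nrm _) (nrm (W w)) (nrm _) (2^-1 ^+ _) (2^-1 ^+ _).
  by move=> a b c d e; lra.
have [w ww] : exists w : H, W (zz n) @[n --> \oo] --> w.
  apply: (@cauchy_bound_cvg _ _ _ _ _ (cvg_geometric_half (2 * K * nrm z))).
  move=> k m km.
  rewrite nrmC; have := Wzz k (m - k)%N; rewrite subnKC // => h.
  by rewrite (le_trans h) // gerBl !mulr_ge0 // ltW.
(* Closed graph: [zz n = U (W (zz n))] tends to [U w] by continuity of [U], while it tends to 0;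
   injectivity then gives [w = 0]. *)
have Uw : U w = 0.
  have Uzz : zz n @[n --> \oo] --> U w.
    by have := cvg_bounded_linear UM ww; under eq_fun do rewrite WU.
  have zz0 : zz n @[n --> \oo] --> (0 : H).
    apply: (cvg_nrm_squeeze _ (cvg_geometric_half (nrm z))) => k.
    by rewrite subr0.
  exact: cvg_unique Uzz zz0.
have w0 : w = 0 by rewrite -(UW w) Uw linear0.
rewrite w0 in ww.
rewrite -[W z]subr0.
apply: (@nrm_lim_le _ _ (fun k => W z - W (zz k))).
  exact: cvgB (cvg_cst _) ww.
near=> k; rewrite (le_trans (Wzz 0 k)) // expr0 mulr1 gerBl !mulr_ge0 //.
by rewrite ltW.
Unshelve. all: end_near. Qed.

End BoundedInverse.

(** Presents a block of a series as a full partial sum of a truncated sequence, so that bounds on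
    partial sums apply to blocks. *)
Lemma sum_tail (V : zmodType) (u : nat -> V) n m : (n <= m)%N ->
  \sum_(k < m) (if (k < n)%N then 0 else u k) =
  \sum_(k < m) u k - \sum_(k < n) u k.
Proof.
move=> nm; rewrite -!(big_mkord xpredT u).
rewrite -(big_mkord xpredT (fun k => if (k < n)%N then 0 else u k)).
rewrite !(@big_cat_nat _ _ _ n 0 m) //= addrAC subrr add0r.
rewrite big_nat_cond big1 ?add0r; last by move=> i /andP[/andP[_ ->]].
by apply: eq_big_nat => i /andP[ni _]; rewrite ltnNge ni.
Qed.

(** * Square-summable sequences and their norm *)

Section SquareSummableSequences.
Context (R : realType).
Implicit Types (c : nat -> R[i]).

Let sq_mono c : nondecreasing_seq (series (fun k => normc (c k) ^+ 2 : R)).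
Proof.
by apply: nondecreasing_series => k _ _; rewrite exprn_ge0 // normc_ge0.
Qed.

Lemma l2norm_ge0 c : 0 <= l2norm c.
Proof. exact: sqrtr_ge0. Qed.

Lemma cvg_l2norm c : l2 c ->
  \sum_(k < n) normc (c k) ^+ 2 @[n --> \oo] --> l2norm c ^+ 2.
Proof.
move=> lc; rewrite sqr_sqrtr; first by move: lc; rewrite /l2 /= seriesEord.
apply: limr_ge => //; near=> n; rewrite seriesEord.
by apply: sumr_ge0 => k _; rewrite exprn_ge0 // normc_ge0.
Unshelve. all: end_near. Qed.

Lemma sum_le_l2norm c n : l2 c ->
  \sum_(k < n) normc (c k) ^+ 2 <= l2norm c ^+ 2.
Proof.
move=> lc; have := nondecreasing_cvgn_le (@sq_mono c) lc n.
by rewrite -(cvg_lim _ (cvg_l2norm lc)) // seriesEord.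
Qed.

Lemma l2_bounded c (B : R) : 0 <= B ->
    (forall n, \sum_(k < n) normc (c k) ^+ 2 <= B ^+ 2) ->
  l2 c /\ l2norm c <= B.
Proof.
move=> B0 cB; have lc : l2 c.
  apply: nondecreasing_is_cvgn; first exact: sq_mono.
  exists (B ^+ 2) => _ [n _ <-]; rewrite seriesEord; exact: cB.
split=> //; rewrite -(@ler_pXn2r _ 2) ?nnegrE ?l2norm_ge0 //.
rewrite -(cvg_lim _ (cvg_l2norm lc)) //; apply: limr_le.
  by apply/cvg_ex; exists (l2norm c ^+ 2); exact: cvg_l2norm.
by near=> n.
Unshelve. all: end_near. Qed.

End SquareSummableSequences.

(** * Bessel families, orthonormal expansions and adjoints *)

Section InnerProduct.
Context (R : realType) (H : completeNormedModType R[i]).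
Context (dot : {dot H for @Num.conj R[i]}).
Hypothesis normE : forall x : H, `|x| ^+ 2 = dot x x.
Implicit Types (x y : H) (f e : nat -> H) (c : nat -> R[i]).

Lemma nrm_sqr x : (nrm x ^+ 2)%:C = dot x x.
Proof. by rewrite rmorphXn /= nrmE normE. Qed.

Lemma dotC x y : dot x y = Num.conj (dot y x).
Proof. by rewrite hermC expr0 mul1r. Qed.

Lemma dotZl a x y : dot (a *: x) y = a * dot x y.
Proof. by rewrite linearZl_LR. Qed.

Lemma dotZr a x y : dot x (a *: y) = Num.conj a * dot x y.
Proof. by rewrite linearZr_LR. Qed.

Lemma dotBl x y z : dot (x - y) z = dot x z - dot y z.
Proof. by rewrite linearBl. Qed.

Lemma dotBr x y z : dot x (y - z) = dot x y - dot x z.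
Proof. by rewrite linearBr. Qed.

Lemma dot_suml n f y : dot (\sum_(k < n) f k) y = \sum_(k < n) dot (f k) y.
Proof. by rewrite linear_sumlz. Qed.

Lemma dot_sumr n f x : dot x (\sum_(k < n) f k) = \sum_(k < n) dot x (f k).
Proof. by rewrite linear_sumr. Qed.

Lemma normc_sqr (z : R[i]) : (normc z ^+ 2)%:C = z * Num.conj z.
Proof. by rewrite rmorphXn /= -normCK. Qed.

(** Cauchy-Schwarz, from the nonnegative square norm of [n%:C *: x - a *: y] with [n = nrm y ^+ 2]
    and [a = dot x y]; this choice avoids division. *)
Lemma normc_dot_le x y : normc (dot x y) <= nrm x * nrm y.
Proof.
have [->|y0] := eqVneq y 0; first by rewrite linear0r nrm0 mulr0 normc0.
have ny : 0 < nrm y by rewrite nrm_gt0.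
set a := dot x y; set n := nrm y ^+ 2.
have h : nrm (n%:C *: x - a *: y) ^+ 2 = n * (n * nrm x ^+ 2 - normc a ^+ 2).
  apply: complexI; rewrite nrm_sqr dotBl !dotBr !dotZl !dotZr -!nrm_sqr.
  rewrite (dotC y x).
  rewrite -/a -/n (_ : Num.conj n%:C = n%:C); last exact: conjc_real.
  by clearbody n; rewrite [RHS]rmorphM /= rmorphB /= normc_sqr rmorphM /=; ring.
have n0 : 0 < n by rewrite exprn_gt0.
have : 0 <= n * (n * nrm x ^+ 2 - normc a ^+ 2).
  by rewrite -h exprn_ge0 // nrm_ge0.
rewrite pmulr_rge0 // subr_ge0 => h2.
rewrite -(@ler_pXn2r _ 2) ?nnegrE ?mulr_ge0 ?normc_ge0 ?nrm_ge0 //.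
by rewrite exprMn mulrC.
Qed.

Lemma cvg_dotl (u : nat -> H) x y : u @ \oo --> x ->
  (dot (u n) y : R[i]^o) @[n --> \oo] --> (dot x y : R[i]^o).
Proof.
move=> /cvg_nrmP ux.
apply: (@cvg_nrm_squeeze _ _ _ _ (fun n => nrm (u n - x) * nrm y)) => [n|].
  by rewrite -linearBl; apply: normc_dot_le.
by rewrite -[X in _ --> X](mul0r (nrm y)); apply: cvgMl.
Qed.

Lemma complete_dot_eq0 f x :
  complete_sequence f -> (forall k, dot x (f k) = 0) -> x = 0.
Proof.
move=> cf xf; have x_span y : linear_span f y -> dot x y = 0.
  move=> [n [a ->]]; rewrite (dot_sumr _ (fun k => a k *: f k)) big1 // => k _.
  by rewrite dotZr xf mulr0.
apply/eqP; apply: contraT => x0; have nx : 0 < nrm x by rewrite nrm_gt0.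
have : closure (linear_span f) x by rewrite cf.
(* If [x] is nonzero, this ball contains some [y] in the span; orthogonality gives
   [nrm x ^+ 2 = dot x (x - y)], which is less than [nrm x ^+ 2] by Cauchy-Schwarz. *)
have bx : nbhs x (ball x (nrm x)%:C) by apply: nbhsx_ballx; rewrite ltcR.
move=> /(_ _ bx)[y [/x_span xy]]; rewrite -ball_normE /= -nrmE ltcR.
have : nrm x ^+ 2 <= nrm x * nrm (x - y).
  rewrite (le_trans _ (normc_dot_le _ _)) // dotBr xy subr0 -nrm_sqr.
  by rewrite normc_real // exprn_ge0 // nrm_ge0.
rewrite expr2 ler_pM2l // => h1 h2. by have := le_lt_trans h1 h2; rewrite ltxx.
Qed.

(** The synthesis map of [f] on finite sequences is bounded by [M]; for nonnegative [M] this is the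
    Bessel condition with bound [M ^+ 2]. *)
Definition bessel_bound f (M : R) := forall n c,
  nrm (\sum_(k < n) c k *: f k) ^+ 2 <= M ^+ 2 * \sum_(k < n) normc (c k) ^+ 2.

(** Analysis is dual to synthesis: pairing [x] with [v], the synthesis of its own first [n]
    coefficients, returns their square sum [s], so [s ^+ 2] is at most [nrm x ^+ 2 * (M ^+ 2 * s)],
    and one factor [s] cancels. *)
Lemma bessel_analysis f (M : R) x : 0 <= M -> bessel_bound f M ->
  l2 (fun k => dot x (f k)) /\ l2norm (fun k => dot x (f k)) <= M * nrm x.
Proof.
move=> M0 fM; apply: l2_bounded => [|n]; first by rewrite mulr_ge0 ?nrm_ge0.
set s := \sum_(k < n) _; pose v := \sum_(k < n) dot x (f k) *: f k.
have s0 : 0 <= s by apply: sumr_ge0 => k _; rewrite exprn_ge0 // normc_ge0.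
have sE : normc (dot x v) = s.
  suff -> : dot x v = s%:C by rewrite normc_real.
  rewrite (dot_sumr _ (fun k => dot x (f k) *: f k)) rmorph_sum.
  apply: eq_bigr => k _ /=.
  by rewrite dotZr normc_sqr mulrC.
have sv : s <= nrm x * nrm v by rewrite -sE normc_dot_le.
have vs : nrm v ^+ 2 <= M ^+ 2 * s := fM n (fun k => dot x (f k)).
have [->|sn0] := eqVneq s 0; first by rewrite exprn_ge0 // mulr_ge0 ?nrm_ge0.
have sp : 0 < s by rewrite lt_def sn0.
rewrite -(ler_pM2r sp) -expr2.
have : s ^+ 2 <= (nrm x * nrm v) ^+ 2.
  by rewrite ler_pXn2r ?nnegrE // mulr_ge0 ?nrm_ge0.
move=> /le_trans; apply; rewrite !exprMn (mulrC (M ^+ 2)) -[leRHS]mulrA.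
by rewrite ler_wpM2l // exprn_ge0 // nrm_ge0.
Qed.

(** The Bessel bound on blocks makes the partial sums Cauchy with rate [b n], which tends to 0; the
    value [b 0] is the asserted norm bound. *)
Lemma bessel_synthesis f (M : R) c : 0 <= M -> bessel_bound f M -> l2 c ->
  exists x : H, \sum_(k < n) c k *: f k @[n --> \oo] --> x /\
    nrm x <= M * l2norm c.
Proof.
move=> M0 fM lc.
pose s n := \sum_(k < n) normc (c k) ^+ 2.
pose b n := M * Num.sqrt (l2norm c ^+ 2 - s n).
have sle : forall n, s n <= l2norm c ^+ 2 by move=> n; apply: sum_le_l2norm.
have cauchy n m : (n <= m)%N ->
    nrm (\sum_(k < m) c k *: f k - \sum_(k < n) c k *: f k) <= b n.
  move=> nm; rewrite -(sum_tail (fun k => c k *: f k)) //.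
  have := fM m (fun k => if (k < n)%N then 0 else c k).
  rewrite (eq_bigr
    (fun k : 'I_m => if (k < n)%N then 0 else c k *: f k)); last first.
    by move=> k _; case: ifP => _ //; rewrite scale0r.
  rewrite [in X in _ <= X -> _](eq_bigr
    (fun k : 'I_m => if (k < n)%N then 0 else normc (c k) ^+ 2)); last first.
    by move=> k _; case: ifP => _ //; rewrite normc0 expr0n.
  rewrite (sum_tail (fun k => normc (c k) ^+ 2)) // -/(s m) -/(s n) => h.
  have sn := sle n; have sm := sle m.
  rewrite -(@ler_pXn2r _ 2) ?nnegrE ?nrm_ge0 ?mulr_ge0 ?sqrtr_ge0 //.
  rewrite (le_trans h) // exprMn sqr_sqrtr ?subr_ge0 //.
  by rewrite ler_wpM2l ?exprn_ge0 // lerD2r.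
have b0 : b @ \oo --> (0 : R).
  rewrite -[X in _ --> X](mulr0 M); apply: cvgMr.
  rewrite -[X in _ --> X]sqrtr0; apply: continuous_cvg.
    exact: sqrt_continuous.
  rewrite -[X in _ --> X](subrr (l2norm c ^+ 2)).
  by apply: cvgB; [exact: cvg_cst | exact: cvg_l2norm].
have [x cx] := cauchy_bound_cvg cauchy b0.
exists x; split => //; apply: nrm_lim_le cx _; near=> n.
have := cauchy 0%N n (leq0n n); rewrite big_ord0 subr0 /b /s big_ord0 subr0.
by rewrite sqrtr_sqr ger0_norm // l2norm_ge0.
Unshelve. all: end_near. Qed.

Lemma dot_series f c x y : \sum_(k < n) c k *: f k @[n --> \oo] --> x ->
  (\sum_(k < n) c k * dot (f k) y : R[i]^o) @[n --> \oo] --> (dot x y : R[i]^o).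
Proof.
move=> /(@cvg_dotl _ _ y); under eq_fun => n.
  rewrite (dot_suml _ (fun k => c k *: f k)).
  under eq_bigr => k _ do rewrite dotZl.
  over.
by [].
Qed.

Lemma orthonormal_dot e c n j : (forall i k, dot (e i) (e k) = (i == k)%:R) ->
  dot (\sum_(k < n) c k *: e k) (e j) = if (j < n)%N then c j else 0.
Proof.
move=> eo; rewrite (dot_suml _ (fun k => c k *: e k)).
under eq_bigr => k _ do rewrite dotZl eo.
case: ltnP => [jn|nj].
  rewrite (bigD1 (Ordinal jn)) //= eqxx mulr1 big1 ?addr0 // => k kj.
  by rewrite -val_eqE /= in kj; rewrite (negbTE kj) mulr0.
rewrite big1 // => k _; rewrite (_ : (k == j :> nat) = false) ?mulr0 //.
by rewrite ltn_eqF // (leq_trans (ltn_ord k)).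
Qed.

Lemma orthonormal_bessel e :
  (forall i k, dot (e i) (e k) = (i == k)%:R) -> bessel_bound e 1.
Proof.
move=> eo n c; rewrite expr1n mul1r -lecR nrm_sqr.
rewrite (dot_sumr _ (fun k => c k *: e k)) rmorph_sum.
apply: ler_sum => k _; rewrite dotZr orthonormal_dot // ltn_ord /=.
by rewrite normc_sqr mulrC.
Qed.

Lemma orthonormal_series e c x j :
    (forall i k, dot (e i) (e k) = (i == k)%:R) ->
  \sum_(k < n) c k *: e k @[n --> \oo] --> x -> dot x (e j) = c j.
Proof.
move=> eo /(@cvg_dotl _ _ (e j)) cx.
(* The inner product of the partial sum with [e j] equals [c j] as soon as [n] exceeds [j]. *)
have cj : (cst (c j) : nat -> R[i]^o) @ \oo --> (dot x (e j) : R[i]^o).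
  apply: cvg_trans cx; apply: near_eq_cvg; near=> n.
  rewrite orthonormal_dot // ifT //; near: n; exact: nbhs_infty_gt.
exact: (@cvg_nrm_unique _ R[i]^o _ _ _ cj (cvg_cst _)).
Unshelve. all: end_near. Qed.

(** The Fourier series converges to some [y] by Bessel's inequality, and [y - x] is orthogonal to
    every [e k], hence zero by completeness. *)
Lemma orthonormal_expansion e x : orthonormal_basis dot e ->
  \sum_(k < n) dot x (e k) *: e k @[n --> \oo] --> x.
Proof.
move=> [eo ec].
have [xl _] := bessel_analysis x ler01 (orthonormal_bessel eo).
have [y [ey _]] := bessel_synthesis ler01 (orthonormal_bessel eo) xl.
suff yx : y - x = 0 by move: ey; rewrite -[y](subrK x) yx add0r.
apply: (complete_dot_eq0 ec) => k.
rewrite dotBl; apply/eqP; rewrite subr_eq0; apply/eqP.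
exact: (orthonormal_series (c := fun k => dot x (e k)) k eo ey).
Qed.

Lemma bessel_image (U : {linear H -> H}) (M : R) e :
    (forall x, nrm (U x) <= M * nrm x) -> bessel_bound e 1 ->
  bessel_bound (fun k => U (e k)) M.
Proof.
move=> UM eb n c.
have -> : \sum_(k < n) c k *: U (e k) = U (\sum_(k < n) c k *: e k).
  by rewrite linear_sum; apply: eq_bigr => k _; rewrite linearZ.
set v := \sum_(k < n) _.
have M0 : nrm (U v) ^+ 2 <= (M * nrm v) ^+ 2.
  by rewrite ler_pXn2r ?nnegrE ?nrm_ge0 // (le_trans _ (UM v)) ?nrm_ge0.
rewrite (le_trans M0) // exprMn ler_wpM2l ?sqr_ge0 //.
by have := eb n c; rewrite expr1n mul1r.
Qed.

(** The vector [y] is the adjoint of [W] applied to [d], built explicitly as the sum of the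
    [dot d (W (e k)) *: e k]. The adjoint identity holds on each [e k] and extends to [x] through
    its expansion. *)
Lemma adjoint_exists (W : {linear H -> H}) (K : R) e d : 0 <= K ->
    (forall x, nrm (W x) <= K * nrm x) -> orthonormal_basis dot e ->
  exists y, (forall x, dot (W x) d = dot x y) /\ nrm y <= K * nrm d.
Proof.
move=> K0 WK [eo ec]; pose c k := dot d (W (e k)).
have We : bessel_bound (fun k => W (e k)) K.
  exact: bessel_image WK (orthonormal_bessel eo).
have [lc cK] := bessel_analysis d K0 We.
have [y [cy yc]] := bessel_synthesis ler01 (orthonormal_bessel eo) lc.
exists y; split; last by rewrite (le_trans yc) // mul1r.
have ye k : dot (W (e k)) d = dot (e k) y.
  by rewrite (dotC (W _)) (dotC (e k)) (orthonormal_series (c := c) k eo cy).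
move=> x; have xe := @orthonormal_expansion e x (conj eo ec).
have Wxe := @cvg_linear_series _ _ W K (fun k => dot x (e k)) e x WK xe.
have := @dot_series (fun k => W (e k)) (fun k => dot x (e k)) _ d Wxe.
under eq_fun => n.
  under eq_bigr => k _ do rewrite ye.
  over.
move=> /(@cvg_nrm_unique _ R[i]^o _ _ _); apply.
exact: (@dot_series e (fun k => dot x (e k)) _ y xe).
Qed.

End InnerProduct.

(** * Riesz bases: coordinates, completeness and moment problems *)

Section RieszBases.
Context (R : realType) (H : completeNormedModType R[i]).
Context (dot : {dot H for @Num.conj R[i]}).
Hypothesis normE : forall x : H, `|x| ^+ 2 = dot x x.
Implicit Types (x y : H) (f g e : nat -> H) (c d : nat -> R[i]).

Lemma riesz_basis_inverse f : riesz_basis dot f ->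
  exists e (U W : {linear H -> H}) (M K : R),
    [/\ orthonormal_basis dot e, forall k, f k = U (e k),
        cancel U W /\ cancel W U,
        0 <= M /\ (forall x, nrm (U x) <= M * nrm x) &
        0 <= K /\ (forall x, nrm (W x) <= K * nrm x)].
Proof.
move=> [e [U [eo [M UM] [W UW WU] fE]]].
have Wlin : linear W.
  by move=> a x y; rewrite -{1}(WU x) -{1}(WU y) -linearP UW.
pose L : {linear H -> H} := HB.pack W (GRing.isLinear.Build _ _ _ _ W Wlin).
have UM' x : nrm (U x) <= M * nrm x.
  by rewrite -lecR rmorphM /= !nrmE.
have [K LK] := @bounded_inverse _ _ U L M UM' UW WU.
(* Later estimates multiply inequalities by these bounds, so they are made nonnegative. *)
have max_le (A : {linear H -> H}) (B : R) :
    (forall x, nrm (A x) <= B * nrm x) ->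
    0 <= Num.max B 0 /\ forall x, nrm (A x) <= Num.max B 0 * nrm x.
  move=> AB; split=> [|x]; first by rewrite le_max lexx orbT.
  by rewrite (le_trans (AB x)) // ler_wpM2r ?nrm_ge0 // le_max lexx.
by exists e, U, L, (Num.max M 0), (Num.max K 0); split => //; exact: max_le.
Qed.

Lemma riesz_basis_coordinates f : riesz_basis dot f ->
  exists (coef : H -> nat -> R[i]) (M K : R),
    [/\ forall a x y, coef (a *: x + y) = fun k => a * coef x k + coef y k,
        forall x, \sum_(k < n) coef x k *: f k @[n --> \oo] --> x,
        forall x, l2 (coef x) /\ l2norm (coef x) <= K * nrm x &
        [/\ 0 <= K, 0 <= M & forall c, l2 c ->
          exists x, coef x = c /\ nrm x <= M * l2norm c]].
Proof.
move=> /riesz_basis_inverse.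
move=> [e [U [W [M [K [[eo ec] fE [UW WU] [M0 UM] [K0 WK]]]]]]].
have {}fE : f = fun k => U (e k) by apply/funext.
exists (fun x k => dot (W x) (e k)), M, K; split.
- by move=> a x y; apply/funext => k; rewrite linearP linearPl.
- move=> x; have := @orthonormal_expansion _ _ _ normE e (W x) (conj eo ec).
  move=> /(@cvg_linear_series _ _ U M (fun k => dot (W x) (e k)) e _ UM).
  by rewrite WU fE.
- move=> x.
  have [l b] :=
    bessel_analysis normE (W x) ler01 (orthonormal_bessel normE eo).
  by split=> //; rewrite (le_trans b) // mul1r.
split => // c lc.
have [x [ex xb]] := bessel_synthesis ler01 (orthonormal_bessel normE eo) lc.
exists (U x); split.
  apply/funext => k; rewrite UW.
  exact: (orthonormal_series normE (c := c) k eo ex).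
by rewrite (le_trans (UM x)) // ler_wpM2l // (le_trans xb) // mul1r.
Qed.

Lemma riesz_basis_complete f : riesz_basis dot f -> complete_sequence f.
Proof.
move=> /riesz_basis_coordinates[coef [_ [_ [_ xE _ _]]]].
rewrite /complete_sequence -subTset => x _ B Bx.
have [N _ NB] := xE x B Bx.
exists (\sum_(k < N) coef x k *: f k); split; last exact: NB (leqnn N).
by exists N, (coef x).
Qed.

(** The moment problem is solved by applying the adjoint of [W] to [z], the sum of the [d j *: e j]:
    pairing the result with [U (e j)] gives [dot z (W (U (e j)))], which is [d j]. *)
Lemma riesz_basis_moments g : riesz_basis dot g ->
  exists M K : R,
    [/\ 0 <= M, 0 <= K,
        forall x, l2 (fun j => dot x (g j)) /\
                  l2norm (fun j => dot x (g j)) <= M * nrm x &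
        forall d, l2 d ->
          exists y, (fun j => dot y (g j)) = d /\ nrm y <= K * l2norm d].
Proof.
move=> /riesz_basis_inverse.
move=> [e [U [W [M [K [[eo ec] gE [UW WU] [M0 UM] [K0 WK]]]]]]].
have {}gE : g = fun k => U (e k) by apply/funext.
exists M, K; split => //.
  move=> x; apply: (bessel_analysis normE x M0); rewrite gE.
  exact: bessel_image UM (orthonormal_bessel normE eo).
move=> d ld.
have [z [dz zb]] := bessel_synthesis ler01 (orthonormal_bessel normE eo) ld.
have [y [Wy yb]] := adjoint_exists normE z K0 WK (conj eo ec).
exists y; split; last first.
  by rewrite (le_trans yb) // ler_wpM2l // (le_trans zb) // mul1r.
apply/funext => k; rewrite dotC -Wy gE UW -dotC.
exact: (orthonormal_series normE (c := d) k eo dz).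
Qed.

End RieszBases.

(** * The cross-Gram operator in coordinates along [f] *)

Theorem theorem2p7 (R : realType) (H : completeNormedModType R[i])
    (dot : {dot H for @Num.conj R[i]})
    (normE : forall x : H, `|x| ^+ 2 = dot x x)
    (f g : nat -> H) (rf : riesz_basis dot f) (rg : riesz_basis dot g) :
  [/\ complete_sequence f, complete_sequence g &
      defines_bounded_invertible (cross_gram dot f g)].
Proof.
have cg := riesz_basis_complete normE rg.
split; [exact: (riesz_basis_complete normE rf)|exact: cg|].
have [coef [M [K [coefD fE coefK [K0 M0 coefM]]]]] :=
  riesz_basis_coordinates normE rf.
have [M' [K' [M'0 K'0 gM gK]]] := riesz_basis_moments normE rg.
pose T := matrix_operator (cross_gram dot f g).
have series_cvg x j :
    matrix_series (cross_gram dot f g) (coef x) j @ \oo -->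
    (dot x (g j) : R[i]^o).
  rewrite /matrix_series seriesEord.
  exact: (@dot_series _ _ _ normE f (coef x) x (g j) (fE x)).
have TE x : T (coef x) = fun j => dot x (g j).
  apply/funext => j; have xj := series_cvg x j.
  exact: (@cvg_nrm_unique _ R[i]^o _ _ _ (cvgP _ xj) xj).
have g_inj x y : (fun j => dot x (g j)) = (fun j => dot y (g j)) -> x = y.
  move=> xy; apply/eqP; rewrite -subr_eq0; apply/eqP.
  apply: (complete_dot_eq0 normE cg) => j.
  by rewrite dotBl (congr1 (@^~ j) xy) subrr.
have Tl2 c : l2 c -> l2 (T c).
  by move=> /coefM[x [<- _]]; rewrite TE; case: (gM x).
rewrite /defines_bounded_invertible -/T; split.
- by move=> c /coefM[x [<- _]] j; apply: cvgP; exact: series_cvg.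
- split=> [c|a c d|]; first exact: Tl2.
    move=> /coefM[x [<- _]] /coefM[y [<- _]].
    rewrite -coefD !TE; apply/funext => j; exact: linearPl.
  exists (M' * M) => c /coefM[x [<- xM]]; rewrite TE.
  case: (gM x) => _ h; rewrite (le_trans h) // -mulrA ler_wpM2l //.
have [y yP] : exists y : (nat -> R[i]) -> H, forall d, l2 d ->
    (fun j => dot (y d) (g j)) = d /\ nrm (y d) <= K' * l2norm d.
  (* Membership in [l2] is placed under the existential so that [choice] yields a map on all
     sequences; outside [l2] it takes the default value 0. *)
  have h d : exists z, l2 d ->
      (fun j => dot z (g j)) = d /\ nrm z <= K' * l2norm d.
    have [/gK[z zP]|nd] := pselect (l2 d); first by exists z.
    by exists 0.
  by have [y yP] := choice h; exists y.
split.
  split=> [c|c d|d] /=; first exact: Tl2.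
    rewrite !inE => /coefM[x [<- _]] /coefM[z [<- _]].
    by rewrite !TE => /g_inj ->.
  move=> ld; exists (coef (y d)); first by case: (coefK (y d)).
  by rewrite TE; case: (yP d ld).
(* The inverse solves the moment problem for [d] and takes coordinates along [f]. *)
exists (fun d => coef (y d)); last first.
  move=> c /coefM[x [<- _]]; congr coef; apply: g_inj; rewrite TE.
  by case: (yP (fun j => dot x (g j))) => //; case: (gM x).
split=> [d _|a c d lc ld|]; first by case: (coefK (y d)).
  (* The choice of [y] is not linear by construction; linearity follows because moments along [g]
     determine the vector. *)
  rewrite -coefD; congr coef; apply: g_inj.
  have [yc _] := yP c lc; have [yd _] := yP d ld.
  have acd : (fun j => dot (a *: y c + y d) (g j)) = (fun k => a * c k + d k).
    by rewrite -{2}yc -{2}yd; apply/funext => j; exact: linearPl.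
  have l2acd : l2 (fun k => a * c k + d k).
    by rewrite -acd; case: (gM (a *: y c + y d)).
  by rewrite acd; case: (yP _ l2acd).
exists (K * K') => d ld; case: (coefK (y d)) => _ h.
by rewrite (le_trans h) // -mulrA ler_wpM2l //; case: (yP d ld).
Qed.
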